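(* Let $T$ be a $t$-norm, $S$ a positive $t$-conorm and $N$ a non-filling fuzzy negation, and let $I_{S,N,T}(x,y)=S(N(T(x,N(y))),N(x))$ for $x,y\in[0,1]$. Then $I_{S,N,T}(x,x)=1$ for all $x\in[0,1]$ if and only if $T(N(x),x)=0$ for all $x\in[0,1]$.
   Context: A $t$-norm is a function $T:[0,1]^2\to[0,1]$ that is commutative, associative, non-decreasing in each argument and satisfies $T(x,1)=x$. A $t$-conorm is a function $S:[0,1]^2\to[0,1]$ that is commutative, associative, non-decreasing in each argument and satisfies $S(x,0)=x$; it is positive if $S(x,y)=1$ implies $x=1$ or $y=1$. A fuzzy negation is a non-increasing $N:[0,1]\to[0,1]$ with $N(0)=1$, $N(1)=0$; it is non-filling if $N(x)=1$ holds only for $x=0$. *)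

(* Defs.v *)
From mathcomp Require Export all_boot all_order all_algebra.
From mathcomp Require Export interval_inference reals.
Export Order.TTheory GRing.Theory Num.Theory.

Set Implicit Arguments.
Unset Strict Implicit.
Unset Printing Implicit Defensive.

Local Open Scope ring_scope.

Section FuzzyConnectives.
Variable R : realType.
Implicit Types (T S : {i01 R} -> {i01 R} -> {i01 R}) (N : {i01 R} -> {i01 R}).

Definition nondecreasing2 T : Prop :=
  (forall y, {homo (fun x => T x y) : a b / a <= b}) /\
  (forall x, {homo T x : a b / a <= b}).

Definition is_tnorm T : Prop :=
  [/\ commutative T, associative T, nondecreasing2 T & right_id 1%:i01 T].

Definition is_tconorm S : Prop :=
  [/\ commutative S, associative S, nondecreasing2 S & right_id 0%:i01 S].

Definition positive_conorm S : Prop :=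
  forall x y, S x y = 1%:i01 -> x = 1%:i01 \/ y = 1%:i01.

Definition is_fuzzy_negation N : Prop :=
  [/\ {homo N : a b /~ a <= b}, N 0%:i01 = 1%:i01 & N 1%:i01 = 0%:i01].

Definition non_filling N : Prop := forall x, N x = 1%:i01 -> x = 0%:i01.

Definition SNT_implication S N T (x y : {i01 R}) : {i01 R} :=
  S (N (T x (N y))) (N x).

End FuzzyConnectives.

(* Main.v *)
Require Import Defs.
From mathcomp Require Import all_boot all_order all_algebra.
From mathcomp Require Import interval_inference reals.
Local Open Scope ring_scope.

(** Positivity of [S] together with [S 1 y = 1] makes [S a b = 1] equivalent to [a = 1] or [b = 1],
    and [N 0 = 1] with non-filling makes [N z = 1] equivalent to [z = 0]. So the identity at [x]
    says that [T x (N x) = 0] or [x = 0], and the second case is an instance of the first. *)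

Lemma tnorm1x (R : realType) (T : {i01 R} -> {i01 R} -> {i01 R}) :
  is_tnorm T -> left_id 1%:i01 T.
Proof. by move=> [TC _ _ Tx1] x; rewrite TC Tx1. Qed.

(** Monotonicity in the second argument gives [1 = S 1 0 <= S 1 x], and 1 is the top of the
    interval. *)
Lemma tconorm1x (R : realType) (S : {i01 R} -> {i01 R} -> {i01 R}) :
  is_tconorm S -> left_zero 1%:i01 S.
Proof.
move=> [_ _ [_ S_homo] Sx0] x; apply/le_anti/andP; split.
  by rewrite -num_le /=; exact: le1.
by rewrite -[leLHS]Sx0; apply: S_homo; rewrite -num_le /=.
Qed.

Theorem theorem3p1 (R : realType)
    (T S : {i01 R} -> {i01 R} -> {i01 R}) (N : {i01 R} -> {i01 R})
    (hT : is_tnorm T)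
    (hS : is_tconorm S) (hSpos : positive_conorm S)
    (hN : is_fuzzy_negation N) (hNnf : non_filling N) :
  (forall x : {i01 R}, SNT_implication S N T x x = 1%:i01) <->
  (forall x : {i01 R}, T (N x) x = 0%:i01).
Proof.
have [_ N0 _] := hN; have [TC _ _ _] := hT.
split=> [I1 x|T0 x]; last first.
  by rewrite /SNT_implication TC T0 N0 tconorm1x.
have [/hNnf|/hNnf ->] := hSpos _ _ (I1 x); first by rewrite TC.
(* Here [N x = 1] has forced [x = 0], so the goal is [T (N 0) 0 = T 1 0 = 0]. *)
by rewrite N0 tnorm1x.
Qed.
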